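(* Let $n\ge3$ and let $H=\langle a_1,\ldots,a_n\rangle$ be a numerical semigroup minimally generated by $a_1,\ldots,a_n$, and assume that $$\mathrm{PF}(H)=\{h+\alpha,h+2\alpha,\ldots,h+(n-1)\alpha\}$$ for integers $h\ge0$ and $\alpha>0$. For $1\le i\le n$ put $m_i=\min\{\ell>0 : \ell a_i+\alpha\in H\}$ and $M_i=m_i-1$, and set $h'=M_1a_1+\cdots+M_na_n$. Then the following statements are equivalent: 1) $h$ has a unique factorization in $H$; 2) $h'=h$; 3) $h'+\alpha\notin H$.
   Context: $\mathbb N=\{0,1,2,\ldots\}$. A numerical semigroup is a submonoid $H$ of $\mathbb N$ (containing $0$) with finite complement in $\mathbb N$; $\langle a_1,\ldots,a_n\rangle$ is the set of all $\mathbb N$-linear combinations of $a_1,\ldots,a_n$. The set of pseudo-Frobenius numbers is $\mathrm{PF}(H)=\{f\in\mathbb Z\setminus H : f+s\in H \text{ for every } 0<s\in H\}$. In the definition of $m_i$, $\ell$ ranges over positive integers. A factorization of $h$ in $H=\langle a_1,\ldots,a_n\rangle$ is a tuple $(q_1,\ldots,q_n)\in\mathbb N^n$ with $h=\sum_i q_ia_i$; $h$ has a unique factorization if there is exactly one such tuple. *)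

(* Defs.v *)
From mathcomp Require Import all_boot all_order all_algebra.
From mathcomp Require Import boolp classical_sets cardinality.

Set Implicit Arguments.
Unset Strict Implicit.
Unset Printing Implicit Defensive.

Local Open Scope classical_set_scope.

Definition numerical_semigroup (H : set nat) : Prop :=
  [/\ H 0, forall x y, H x -> H y -> H (x + y) & finite_set (~` H)].

Definition factorization (n : nat) (a : 'I_n -> nat) (h : nat)
    (q : {ffun 'I_n -> nat}) : Prop :=
  h = \sum_(i < n) q i * a i.

Definition has_unique_factorization (n : nat) (a : 'I_n -> nat) (h : nat) :
    Prop :=
  exists! q, factorization a h q.

Definition generated (n : nat) (a : 'I_n -> nat) : set nat :=
  [set h | exists q, factorization a h q].

Definition generated_by_subset (n : nat) (a : 'I_n -> nat) (A : {set 'I_n}) :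
    set nat :=
  [set h | exists q : {ffun 'I_n -> nat}, h = \sum_(i in A) q i * a i].

(* Subfamilies are indexed by sets of indices, so minimality also forces the
   [a i] to be pairwise distinct and nonzero. *)
Definition minimally_generated (n : nat) (H : set nat) (a : 'I_n -> nat) :
    Prop :=
  H = generated a /\
  forall A : {set 'I_n},
    A \proper [set: 'I_n]%SET -> generated_by_subset a A <> H.

Definition int_set (H : set nat) : set int := Posz @` H.

Definition PF (H : set nat) : set int :=
  [set f : int | ~ int_set H f /\
     forall s : nat, 0 < s -> H s -> int_set H (f + s%:Z)%R].

(* The default value 0 is used only when [S] is empty. *)
Definition min_nat (S : set nat) : nat :=
  xget 0 [set l | S l /\ forall k, S k -> l <= k].

Lemma min_natP (S : set nat) :
  S !=set0 -> S (min_nat S) /\ forall k, S k -> min_nat S <= k.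
Proof.
move=> [x Sx]; rewrite /min_nat; case: xgetP => [l _ //|/= noS].
have exS : exists k, `[< S k >] by exists x; apply/asboolP.
case: (ex_minnP exS) => l /asboolP Sl minl.
by case: (noS l); split=> // k Sk; apply: minl; apply/asboolP.
Qed.

Definition m_ (n : nat) (H : set nat) (a : 'I_n -> nat) (alpha : nat)
    (i : 'I_n) : nat :=
  min_nat [set l | 0 < l /\ H (l * a i + alpha)].

Definition M_ (n : nat) (H : set nat) (a : 'I_n -> nat) (alpha : nat)
    (i : 'I_n) : nat :=
  m_ H a alpha i - 1.

Definition h_prime (n : nat) (H : set nat) (a : 'I_n -> nat) (alpha : nat) :
    nat :=
  \sum_(i < n) M_ H a alpha i * a i.

(* Main.v *)
(** For [x] in [H] one has [x + alpha \notin H] iff [h - x \in H]: if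
    [x + alpha \notin H], some pseudo-Frobenius number [h + k alpha] exceeds it
    by an element of [H], so [h + (k - 1) alpha \in H], which forces [k = 1].
    Applied to [x = l a_i] this says that [M_i] is the largest coefficient of
    [a_i] in any factorization of [h], and that this value is attained.  Hence
    [h <= h'], with equality only for the factorization [(M_1, ..., M_n)], and
    a unique factorization has to be that one. *)

Require Import Defs.
From mathcomp Require Import all_boot all_order all_algebra.
From mathcomp Require Import boolp classical_sets cardinality.
From mathcomp Require Import zify.

Set Implicit Arguments.
Unset Strict Implicit.
Unset Printing Implicit Defensive.

Local Open Scope classical_set_scope.

Lemma int_setE (H : set nat) (x : nat) : int_set H (Posz x) <-> H x.
Proof. by split=> [[y Hy [<-]] //|Hx]; exists x. Qed.

Lemma PF_natE (H : set nat) (f : nat) :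
  PF H (Posz f) <-> ~ H f /\ forall s, 0 < s -> H s -> H (f + s).
Proof.
split=> -[Hf Hfs].
  split=> [/int_setE //|s s0 Hs].
  by apply/int_setE; rewrite PoszD; apply: Hfs.
split=> [/int_setE //|s s0 Hs].
by rewrite -PoszD; apply/int_setE; apply: Hfs.
Qed.

Lemma numerical_semigroup_cofinite (H : set nat) :
  numerical_semigroup H -> exists N, forall x, N <= x -> H x.
Proof.
case=> _ _ /finite_seqP [s sE]; exists (\max_(x <- s) x).+1 => x Nx.
apply: contrapT => nHx; have xs : x \in s by have : [set` s] x by rewrite -sE.
by move: Nx; rewrite ltnNge leq_bigmax_seq.
Qed.

(** A gap that is not pseudo-Frobenius stays a gap after adding some positive element of [H].
    Iterating this climb must stop, since all gaps lie below [N]; the induction is on [N - z]. *)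
Lemma PF_above_gap (H : set nat) (z : nat) :
  numerical_semigroup H -> ~ H z -> exists2 s, H s & PF H (Posz (z + s)).
Proof.
move=> Hsg; have [N HN] := numerical_semigroup_cofinite Hsg.
case: Hsg => H0 HD _; have [k] := ubnP (N - z).
elim: k z => // k IHk z zk nHz.
have [|npf] := pselect (PF H (Posz z)); first by exists 0; rewrite ?addn0.
have [s [s0 Hs nHzs]] : exists s, [/\ 0 < s, H s & ~ H (z + s)].
  apply: contrapT => nex; apply: npf; apply/PF_natE; split=> // s s0 Hs.
  by apply: contrapT => nHzs; apply: nex; exists s.
have zN : z < N by rewrite ltnNge; apply/negP => /HN.
have [||t Ht pf] := IHk (z + s) => //; first lia.
by exists (s + t); [exact: HD|rewrite addnA].
Qed.

Lemma generator_in (n : nat) (a : 'I_n -> nat) (i : 'I_n) (l : nat) :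
  generated a (l * a i).
Proof.
exists [ffun j => if j == i then l else 0].
rewrite /factorization (bigD1 i) //= ffunE eqxx big1 ?addn0 // => j /negbTE ji.
by rewrite ffunE ji.
Qed.

(** A zero generator could be dropped without changing the generated set. *)
Lemma minimal_generator_gt0 (n : nat) (H : set nat) (a : 'I_n -> nat)
    (i : 'I_n) : minimally_generated H a -> 0 < a i.
Proof.
move=> [-> amin]; rewrite lt0n; apply/eqP => ai0.
apply: (amin ([set: 'I_n] :\ i)%SET); first by apply: properD1; rewrite inE.
apply/seteqP; split=> x [q xq].
  exists [ffun j => if j == i then 0 else q j].
  rewrite /factorization xq [RHS](bigD1 i) //= ffunE eqxx mul0n add0n.
  apply: eq_big => j; first by rewrite !inE andbT.
  by rewrite !inE andbT ffunE => /negbTE ->.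
exists q; rewrite xq (bigD1 i) //= ai0 muln0 add0n.
by apply: eq_bigl => j; rewrite !inE andbT.
Qed.

Section ArithmeticPF.

Variables (n : nat) (H : set nat) (a : 'I_n -> nat) (h alpha : nat).
Hypotheses (n_ge3 : 3 <= n) (Hsg : numerical_semigroup H).
Hypothesis a_minimal : minimally_generated H a.
Hypothesis alpha_gt0 : 0 < alpha.
Hypothesis PF_H :
  PF H = [set Posz (h + k * alpha) | k in [set k : nat | 1 <= k <= n - 1]].

Lemma PF_arithP (k : nat) : 1 <= k <= n - 1 ->
  ~ H (h + k * alpha) /\ forall s, 0 < s -> H s -> H (h + k * alpha + s).
Proof. by move=> kn; apply/PF_natE; rewrite PF_H; exists k. Qed.

Lemma addn_alpha_gap (x : nat) : H x ->
  ~ H (x + alpha) <-> exists2 y, H y & x + y = h.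
Proof.
move=> Hx; have [H0 HD _] := Hsg; split=> [nHxa|[y Hy xyh] Hxa].
  have [s Hs] := PF_above_gap Hsg nHxa.
  rewrite PF_H => -[k /= kn [kE]].
  have [k1|k1] := eqVneq k 1; first by exists s => //; lia.
  have [|nHk _] := PF_arithP (k := k.-1); first lia.
  case: nHk; have -> : h + k.-1 * alpha = x + s by nia.
  exact: HD.
(* Conversely, adding [y] to [x + alpha] would put [h + alpha] in [H]. *)
have [|nH1 _] := PF_arithP (k := 1); first lia.
by apply: nH1; rewrite mul1n -xyh addnAC; apply: HD.
Qed.

(** Otherwise adding [alpha] to the pseudo-Frobenius number [h + alpha] would give [h + 2 * alpha]
    in [H]; this is itself pseudo-Frobenius because [3 <= n]. *)
Lemma alpha_gap : ~ H alpha.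
Proof.
move=> Ha; have [|_ HF] := PF_arithP (k := 1); first lia.
have [|nH2 _] := PF_arithP (k := 2); first lia.
by apply: nH2; rewrite mulSn addnCA addnC; move: (HF _ alpha_gt0 Ha); rewrite !mul1n.
Qed.

Lemma mulgen_in (i : 'I_n) (l : nat) : H (l * a i).
Proof. by case: a_minimal => -> _; exact: generator_in. Qed.

(** The [l] with [l * a i + alpha] in [H] are closed upwards, as multiples of [a i] may be added. *)
Lemma mulgen_alpha_gapE (i : 'I_n) (l : nat) :
  ~ H (l * a i + alpha) <-> l <= M_ H a alpha i.
Proof.
have [N HN] := numerical_semigroup_cofinite Hsg.
have ai0 := minimal_generator_gt0 i a_minimal.
have [|[m0 Hm] mmin] := @min_natP [set l | 0 < l /\ H (l * a i + alpha)].
  by exists N.+1; split=> //; apply: HN; nia.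
rewrite /M_ -/(m_ H a alpha i) in m0 Hm mmin *.
split=> [nHl|lM Hl].
  suff : l < m_ H a alpha i by lia.
  rewrite ltnNge; apply/negP => ml; apply: nHl.
  rewrite -(subnKC ml) mulnDl addnAC; have [_ HD _] := Hsg.
  exact: HD Hm (mulgen_in i _).
(* The minimum ranges over positive [l] only, so [l = 0] needs [alpha_gap]. *)
case: l => [|l] in lM Hl *; first exact: alpha_gap Hl.
by have := mmin l.+1 (conj isT Hl); lia.
Qed.

Lemma in_generatedP (x : nat) : H x -> exists q, factorization a x q.
Proof. by case: a_minimal => -> _. Qed.

Lemma factorization_h_le (q : {ffun 'I_n -> nat}) (i : 'I_n) :
  factorization a h q -> q i <= M_ H a alpha i.
Proof.
move=> hq; apply/mulgen_alpha_gapE/(addn_alpha_gap (mulgen_in i _)).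
exists (\sum_(j < n | j != i) q j * a j); last by rewrite hq [RHS](bigD1 i).
have [H0 HD _] := Hsg.
by apply: (big_ind H) => // j _; exact: mulgen_in.
Qed.

Lemma factorization_h_max (i : 'I_n) :
  exists2 q, factorization a h q & q i = M_ H a alpha i.
Proof.
have /mulgen_alpha_gapE := leqnn (M_ H a alpha i).
move=> /(addn_alpha_gap (mulgen_in i _)) [y /in_generatedP [q yq] hE].
have hq' : factorization a h [ffun j => (if j == i then M_ H a alpha i else 0) + q j].
  rewrite /factorization -hE yq; under [RHS]eq_bigr do rewrite ffunE mulnDl.
  rewrite big_split /=; congr (_ + _).
  rewrite (bigD1 i) //= eqxx big1 ?addn0 // => j /negbTE ->; exact: mul0n.
eexists; first exact: hq'.
(* The coefficient at [i] is [M_i + q i], so the upper bound forces [q i = 0]. *)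
by have := factorization_h_le i hq'; rewrite !ffunE eqxx; lia.
Qed.

(** Each [q i] is at most [M_i], while the weighted sum of the [M_i] does not exceed that of the
    [q i]; as the weights [a i] are positive, no coefficient can be strictly smaller. *)
Lemma factorization_h_eq (q : {ffun 'I_n -> nat}) :
    h_prime H a alpha <= h -> factorization a h q ->
  q = [ffun i => M_ H a alpha i].
Proof.
move=> h'h hq; apply/ffunP => i; rewrite ffunE.
have ai0 := minimal_generator_gt0 i a_minimal.
have qM := factorization_h_le i hq.
have S_le : \sum_(j < n | j != i) q j * a j <=
            \sum_(j < n | j != i) M_ H a alpha j * a j.
  by apply: leq_sum => j _; rewrite leq_mul2r factorization_h_le ?orbT.
apply/eqP; rewrite eqn_leq qM -(leq_pmul2r ai0) /=.
move: h'h; rewrite /h_prime [X in _ <= X]hq !(bigD1 i (P := predT)) //= => h'h.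
rewrite -(leq_add2r (\sum_(j < n | j != i) M_ H a alpha j * a j)).
by rewrite (leq_trans h'h) // leq_add2l.
Qed.

Lemma h_in : H h.
Proof.
have [H0 _ _] := Hsg; have /(addn_alpha_gap H0) [y Hy <- //] : ~ H (0 + alpha).
exact: alpha_gap.
Qed.

Lemma h_prime_in : H (h_prime H a alpha).
Proof.
case: a_minimal => HE _; rewrite {1}HE; exists [ffun i => M_ H a alpha i].
by apply: eq_bigr => i _; rewrite ffunE.
Qed.

End ArithmeticPF.

Theorem theorem3p6 (n : nat) (H : set nat) (a : 'I_n -> nat) (h alpha : nat)
    (n_ge3 : 3 <= n)
    (H_semigroup : numerical_semigroup H)
    (a_minimal : minimally_generated H a)
    (alpha_gt0 : 0 < alpha)
    (PF_H : PF H = [set Posz (h + k * alpha) | k in [set k : nat | 1 <= k <= n - 1]]) :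
  [<-> has_unique_factorization a h;
       h_prime H a alpha = h;
       ~ H (h_prime H a alpha + alpha)].
Proof.
tfae.
- move=> [q [hq q_uniq]]; rewrite [RHS]hq; apply: eq_bigr => i _.
  (* For each [i], the factorization attaining [M_i] must be the unique one. *)
  have [q' hq' <-] :=
    factorization_h_max n_ge3 H_semigroup a_minimal alpha_gt0 PF_H i.
  by rewrite (q_uniq _ hq').
- move=> ->; have [|nH1 _] := PF_arithP PF_H (k := 1); first lia.
  by rewrite mul1n in nH1.
- move=> /(addn_alpha_gap n_ge3 H_semigroup alpha_gt0 PF_H
    (h_prime_in _ a_minimal)) [y _ hE].
  (* Here [h' + y = h], which leaves only one possible factorization of [h]. *)
  have h'h : h_prime H a alpha <= h by lia.
  have [q hq] := in_generatedP a_minimal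
    (h_in n_ge3 H_semigroup alpha_gt0 PF_H).
  exists q; split=> // q' hq'.
  have qE := factorization_h_eq n_ge3 H_semigroup a_minimal alpha_gt0 PF_H h'h.
  by rewrite (qE _ hq) (qE _ hq').
Qed.
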